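(* Let $d\geq 2$ be an integer and let $l,k$ be relatively prime integers with $2\leq l<k$. Let $X_{d,k,l}\subset\mathbb{A}^{4}=\mathrm{Spec}(\mathbb{C}[x,y,z,t])$ be the smooth affine threefold defined by the equation $x^{d}z=y^{l}+x-t^{k}$. Then the cylinder $X_{d,k,l}\times\mathbb{A}^{1}$ has a trivial Makar-Limanov invariant, that is, $\mathrm{ML}(X_{d,k,l}\times\mathbb{A}^{1})=\mathbb{C}$.
   Context: All varieties are over the field $\mathbb{C}$ of complex numbers, $\mathbb{A}^{n}$ denotes affine $n$-space over $\mathbb{C}$, and $\mathbb{G}_{a}$ is the additive group. For an affine variety $X$, the Makar-Limanov invariant $\mathrm{ML}(X)$ is the subring of the coordinate ring $\Gamma(X,\mathcal{O}_{X})$ consisting of the regular functions invariant under all algebraic $\mathbb{G}_{a}$-actions on $X$. Equivalently, $\mathrm{ML}(X)$ is the intersection of the kernels of all locally nilpotent $\mathbb{C}$-derivations of $\Gamma(X,\mathcal{O}_{X})$, where a derivation $\partial$ is locally nilpotent if for every $a$ there is $n\geq 1$ with $\partial^{n}(a)=0$. The invariant is called trivial if it consists of constants only, i.e. $\mathrm{ML}(X)=\mathbb{C}$. The varieties $X_{d,k,l}$ are called Koras-Russell threefolds (of the first kind). *)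

(* Defs.v *)
From mathcomp Require Import all_boot all_order all_algebra.
From mathcomp Require Import boolp classical_sets reals.
From mathcomp Require Import complex mpoly.

Set Implicit Arguments.
Unset Strict Implicit.
Unset Printing Implicit Defensive.

Import GRing.Theory.
Local Open Scope classical_set_scope.
Local Open Scope ring_scope.

(* Affine varieties are represented by their sets of closed points
   V in A^n = 'I_n -> K.  Over an algebraically closed field, a reduced affine
   variety, its regular functions (the restrictions of polynomials) and its
   morphisms are determined by closed points. *)
Section AffineVarieties.
Variable K : fieldType.

Definition points n (V : set ('I_n -> K)) : Type := {v : 'I_n -> K | V v}.

Definition regular n (V : set ('I_n -> K)) (f : points V -> K) : Prop :=
  exists p : {mpoly K[n]}, forall v : points V, f v = p.@[sval v].

Definition morphism n m (V : set ('I_n -> K)) (W : set ('I_m -> K))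
    (phi : points V -> points W) : Prop :=
  forall i : 'I_m, regular (fun v => sval (phi v) i).

(* V x A^1 in A^(n+1), with the coordinate of A^1 put last. *)
Definition cylinder n (V : set ('I_n -> K)) : set ('I_n.+1 -> K) :=
  [set w | V (fun i => w (lift ord_max i))].

Definition cyl_fst n (V : set ('I_n -> K)) (w : points (cylinder V)) :
    points V :=
  exist _ (fun i => sval w (lift ord_max i)) (svalP w).

Definition cyl_snd n (V : set ('I_n -> K)) (w : points (cylinder V)) : K :=
  sval w ord_max.

(* An action mu of the abstract group (K, +) on the points of V is algebraic
   when it is given by a morphism from V x G_a to V, the variety underlying
   G_a being A^1. *)
Definition Ga_action n (V : set ('I_n -> K)) (mu : K -> points V -> points V)
    : Prop :=
  [/\ morphism (fun w : points (cylinder V) => mu (cyl_snd w) (cyl_fst w)),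
      forall v, mu 0 v = v
    & forall a b v, mu (a + b) v = mu a (mu b v)].

Definition ML n (V : set ('I_n -> K)) : set (points V -> K) :=
  [set f | regular f /\
     forall mu, Ga_action mu -> forall a v, f (mu a v) = f v].

(* The coordinates (x, y, z, t) of A^4 are v 0, v 1, v 2, v 3.  The polynomial
   x^d z - y^l - x + t^k is irreducible for k, l >= 1 (it has degree 1 in z
   and x does not divide y^l - t^k), so over an algebraically closed K the
   regular functions on this set form K[x, y, z, t] / (x^d z - y^l - x + t^k). *)
Definition koras_russell (d k l : nat) : set ('I_4 -> K) :=
  [set v | v 0 ^+ d * v 2 = v 1 ^+ l + v 0 - v 3 ^+ k].

End AffineVarieties.

Arguments ML {K n} V.
Arguments koras_russell K d k l : clear implicits.

(* Main.v *)
(** Write X = X_{d,k,l} and A = O(X)[u], where u is the coordinate of A^1. Over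
    t <> 0, Danielewski's trick identifies X x A^1 with Y x A^1, where
    Y = {x Z = y1^l - t^k}. On one side y1 = y - x u. On the other, k-th powers of
    t being invertible, t^k - x has an l-th root F modulo x^d in O(Y)[1/t], which
    is congruent to y1 modulo x, and w = (y - F) / x^d is the coordinate of the
    factor A^1 of Y x A^1. On Y there is the locally nilpotent derivation D with
    D(y1) = Z, D(x) = l y1^(l-1), D(Z) = D(t) = 0, which moves x. Since t is in
    the kernel of D, a multiple t^N D preserves A, and thus gives a G_a-action on
    X x A^1 that moves x and fixes t = 0 pointwise.

    The translations of u and the actions x^d d/dy + l y^(l-1) d/dz and
    x^d d/dt - k t^(k-1) d/dz leave only functions of x invariant where x <> 0;
    the new action then makes them constant on x <> 0 and on t <> 0. The points
    left have x = y = t = 0; they are limits of points with t <> 0. *)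

Require Import Defs.
From mathcomp Require Import all_boot all_order all_algebra.
From mathcomp Require Import boolp classical_sets reals.
From mathcomp Require Import complex mpoly.
From mathcomp Require Import ring.

Set Implicit Arguments.
Unset Strict Implicit.
Unset Printing Implicit Defensive.

Import Order.TTheory GRing.Theory Num.Theory.
Local Open Scope classical_set_scope.
Local Open Scope ring_scope.

Lemma mpoly_ring_ind (K : comNzRingType) n (P : {mpoly K[n]} -> Prop) :
  (forall c, P c%:MP) -> (forall i, P 'X_i) ->
  (forall p q, P p -> P q -> P (p + q)) ->
  (forall p q, P p -> P q -> P (p * q)) -> forall p, P p.
Proof.
move=> Pc PX PD PM; elim/mpolyind=> [|c m p _ _ Pp]; first by rewrite -mpolyC0.
apply: (PD _ _ _ Pp); rewrite -mul_mpolyC mpolyXE_id; apply: (PM) => //.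
apply: (big_ind P) => [|p1 p2|i _]; [by rewrite -mpolyC1|exact: (PM)|].
by elim: (m i) => [|j IH]; rewrite ?expr0 -?mpolyC1 // exprS; apply: (PM).
Qed.

(** * Algebras of functions *)

Section FunctionAlgebras.
Variable K : comNzRingType.

(** The predicate is arbitrary so that one closure proof serves regular functions, functions regular
    after inverting a polynomial, and polynomial functions of one parameter. *)
Definition function_algebra T (C : (T -> K) -> Prop) : Prop :=
  [/\ forall c, C (fun=> c),
      forall f g, C f -> C g -> C (fun w => f w + g w)
    & forall f g, C f -> C g -> C (fun w => f w * g w)].

Section Closure.
Variables (T : Type) (C : (T -> K) -> Prop).
Hypothesis algC : function_algebra C.

Lemma algebra_cst c : C (fun=> c).
Proof. by case: algC. Qed.

Lemma algebraD f g : C f -> C g -> C (fun w => f w + g w).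
Proof. by case: algC => _ H _; apply: H. Qed.

Lemma algebraM f g : C f -> C g -> C (fun w => f w * g w).
Proof. by case: algC => _ _; apply. Qed.

Lemma algebraN f : C f -> C (fun w => - f w).
Proof.
move=> Cf; have := algebraM (algebra_cst (-1)) Cf.
by congr C; apply/funext => w; rewrite mulN1r.
Qed.

Lemma algebraX f n : C f -> C (fun w => f w ^+ n).
Proof.
move=> Cf; elim: n => [|n IH]; first exact: algebra_cst.
by have := algebraM Cf IH; congr C; apply/funext => w; rewrite exprS.
Qed.

Lemma algebra_sum n (F : 'I_n -> T -> K) :
  (forall i, C (F i)) -> C (fun w => \sum_(i < n) F i w).
Proof.
elim: n F => [|n IH] F CF.
  by have := algebra_cst 0; congr C; apply/funext => w; rewrite big_ord0.
have := algebraD (CF ord0) (IH _ (fun i => CF (lift ord0 i))).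
by congr C; apply/funext => w; rewrite big_ord_recl.
Qed.

Lemma algebra_horner (p : {poly K}) f : C f -> C (fun w => p.[f w]).
Proof.
move=> Cf; elim/poly_ind: p => [|p c IH].
  by have := algebra_cst 0; congr C; apply/funext => w; rewrite horner0.
have := algebraD (algebraM IH Cf) (algebra_cst c).
by congr C; apply/funext => w; rewrite hornerMXaddC.
Qed.

Lemma algebra_meval n (p : {mpoly K[n]}) (f : T -> 'I_n -> K) :
  (forall i, C (fun w => f w i)) -> C (fun w => p.@[f w]).
Proof.
move=> Cf; elim/mpoly_ring_ind: p => [c|i|p q Cp Cq|p q Cp Cq].
- by have := algebra_cst c; congr C; apply/funext => w; rewrite mevalC.
- by have := Cf i; congr C; apply/funext => w; rewrite mevalXU.
- by have := algebraD Cp Cq; congr C; apply/funext => w; rewrite mevalD.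
- by have := algebraM Cp Cq; congr C; apply/funext => w; rewrite mevalM.
Qed.

End Closure.
End FunctionAlgebras.

Lemma regular_algebra (K : fieldType) n (V : set ('I_n -> K)) :
  function_algebra (@regular K n V).
Proof.
split=> [c|f g [p fp] [q gq]|f g [p fp] [q gq]].
- by exists c%:MP => v; rewrite mevalC.
- by exists (p + q) => v; rewrite mevalD fp gq.
- by exists (p * q) => v; rewrite mevalM fp gq.
Qed.

Lemma regular_coord (K : fieldType) n (V : set ('I_n -> K)) i :
  regular (fun v : points V => sval v i).
Proof. by exists 'X_i => v; rewrite mevalXU. Qed.

(** * Difference quotients of powers, without division *)

Definition pow_quot (R : comNzRingType) n (x y : R) :=
  \sum_(i < n) x ^+ (n.-1 - i) * y ^+ i.

Section PowQuot.
Variable R : comNzRingType.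
Implicit Types x y : R.

Lemma pow_quotE n x y : x ^+ n - y ^+ n = (x - y) * pow_quot n x y.
Proof. exact: subrXX. Qed.

Lemma pow_quotxx n x : pow_quot n x x = n%:R * x ^+ n.-1.
Proof.
transitivity (\sum_(i < n) x ^+ n.-1); last first.
  by rewrite sumr_const card_ord mulr_natl.
apply: eq_bigr => i _; rewrite -exprD subnK //.
by case: n i => [[]|n i] //; rewrite -ltnS.
Qed.

Lemma horner_pow_quot n (p q : {poly R}) x :
  (pow_quot n p q).[x] = pow_quot n p.[x] q.[x].
Proof. by rewrite horner_sum; apply: eq_bigr => i _; rewrite !hornerE. Qed.

End PowQuot.

(** The quotient ((y + a p)^n - y^n) / p, in a form that still makes sense at p = 0. *)
Definition pow_shift (R : comNzRingType) n (y a p : R) := a * pow_quot n (y + a * p) y.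

Section PowShift.
Variable R : idomainType.
Implicit Types y a b p : R.

Lemma pow_shiftE n y a p : p * pow_shift n y a p = (y + a * p) ^+ n - y ^+ n.
Proof. by rewrite /pow_shift pow_quotE addrAC subrr add0r mulrCA mulrA. Qed.

(** Cocycle rule that makes the actions below additive in time. For p != 0 it telescopes after
    multiplication by p; for p = 0 both sides are linear in the time. *)
Lemma pow_shiftD n y a b p :
  pow_shift n y (a + b) p = pow_shift n y b p + pow_shift n (y + b * p) a p.
Proof.
have [p0|p0] := eqVneq p 0.
  by rewrite /pow_shift p0 !mulr0 !addr0 mulrDl addrC.
apply: (mulfI p0); rewrite mulrDr !pow_shiftE.
by have -> : y + b * p + a * p = y + (a + b) * p; ring.
Qed.

End PowShift.

Lemma algebra_pow_quot (K : comNzRingType) T (C : (T -> K) -> Prop)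
    (algC : function_algebra C) n f g :
  C f -> C g -> C (fun v => pow_quot n (f v) (g v)).
Proof.
move=> Cf Cg; apply: (algebra_sum algC) => i.
by apply: (algebraM algC); apply: (algebraX algC).
Qed.

Ltac function_algebra algC := repeat first
  [ assumption | exact: (algebra_cst algC) | apply: (algebraX algC)
  | apply: (algebraN algC) | apply: (algebraD algC) | apply: (algebraM algC)
  | apply: (algebra_horner algC) | apply: (algebra_pow_quot algC)
  | apply: (algebra_sum algC) => ? ].

(* 1 + 'X * Q truncates the power series ((1 + 'X P1) / (1 + 'X U1))^(1/(n+1)). *)
Lemma poly_root_mod (K : numFieldType) n (U1 P1 : {poly K}) d :
  exists Q E : {poly K},
    (1 + 'X * Q) ^+ n.+1 * (1 + 'X * U1) = 1 + 'X * P1 + 'X^(d.+1) * E.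
Proof.
elim: d => [|d [Q [E IH]]].
  by exists 0, (U1 - P1); rewrite mulr0 addr0 expr1n mul1r expr1; ring.
(* Newton step: this coefficient satisfies (n+1) c + E(0) = 0, so the error gains one more factor
   ['X]. *)
pose c := - E.[0] / n.+1%:R.
pose A : {poly K} := 1 + 'X * Q.
pose A' : {poly K} := 1 + 'X * (Q + c%:P * 'X^d).
have : root (E + c%:P * pow_quot n.+1 A' A * (1 + 'X * U1)) 0.
  rewrite rootE !hornerE horner_pow_quot !hornerE.
  rewrite pow_quotxx expr1n mulr1 /c divfK ?subrr // pnatr_eq0 //.
move=> /factor_theorem[E' E'E]; rewrite subr0 in E'E.
exists (Q + c%:P * 'X^d), E'.
have -> : (1 + 'X * (Q + c%:P * 'X^d)) ^+ n.+1
    = A ^+ n.+1 + (A' - A) * pow_quot n.+1 A' A.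
  by rewrite -pow_quotE addrCA subrr addr0.
rewrite mulrDl IH.
have -> : A' - A = c%:P * 'X^(d.+1) by rewrite /A' /A exprS; ring.
rewrite [in RHS]exprS -[in RHS]mulrA [in RHS]mulrCA [_ * E']mulrC -E'E; ring.
Qed.

(** * Points of a cylinder *)

Section Snoc.
Variable T : Type.

Definition snoc n (v : 'I_n -> T) (a : T) : 'I_n.+1 -> T :=
  fun i => if unlift ord_max i is Some j then v j else a.

Lemma snoc_lift n (v : 'I_n -> T) a j : snoc v a (lift ord_max j) = v j.
Proof. by rewrite /snoc liftK. Qed.

Lemma snoc_max n (v : 'I_n -> T) a : snoc v a ord_max = a.
Proof. by rewrite /snoc unlift_none. Qed.

Lemma snocE n (w : 'I_n.+1 -> T) :
  w = snoc (fun i => w (lift ord_max i)) (w ord_max).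
Proof. by apply/funext => i; rewrite /snoc; case: unliftP => [j|] ->. Qed.

End Snoc.

Lemma points_inj (K : fieldType) n (V : set ('I_n -> K)) (v w : points V) :
  sval v = sval w -> v = w.
Proof. by case: v w => [v Vv] [w Vw] /= vw; apply: eq_exist. Qed.

Lemma cylinder_snoc (K : fieldType) n (V : set ('I_n -> K)) v a :
  V v -> cylinder V (snoc v a).
Proof. by rewrite /cylinder/=; congr V; apply/funext => i; rewrite snoc_lift. Qed.

(** First-order expansion in the last variable. For a flow it isolates the factor a in the
    displacement from time 0. *)
Lemma mpoly_snoc0 (K : comNzRingType) n (p : {mpoly K[n.+1]}) :
  exists q : {mpoly K[n.+1]}, forall v a,
    p.@[snoc v a] = p.@[snoc v 0] + a * q.@[snoc v a].
Proof.
elim/mpoly_ring_ind: p => [c|i|p q [p' pE] [q' qE]|p q [p' pE] [q' qE]].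
- by exists 0 => v a; rewrite !mevalC ?meval0 mulr0 addr0.
- case: (unliftP ord_max i) => [j|] ->.
    by exists 0 => v a; rewrite !mevalXU !snoc_lift ?meval0 mulr0 addr0.
  by exists 1 => v a; rewrite !mevalXU !snoc_max meval1 mulr1 add0r.
- by exists (p' + q') => v a; rewrite !mevalD pE qE; ring.
(* If p = p0 + a p' and q = q0 + a q', then p q - p0 q0 = a (p' q + q' p - a p' q'). *)
- exists (p' * q + q' * p - 'X_ord_max * p' * q') => v a.
  rewrite !(mevalD, mevalM, mevalB, mevalN) mevalXU snoc_max pE qE; ring.
Qed.

(** * Actions defined on a principal open subset *)

Section LocalActions.
Variables (K : fieldType) (n : nat) (V : set ('I_n -> K)).

Lemma Ga_action_of_raw (m : K -> ('I_n -> K) -> 'I_n -> K)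
    (mV : forall a v, V v -> V (m a v)) :
  (forall i, regular (fun w : points (cylinder V) =>
     m (cyl_snd w) (sval (cyl_fst w)) i)) ->
  (forall v, V v -> m 0 v = v) ->
  (forall a b v, V v -> m (a + b) v = m a (m b v)) ->
  Ga_action (fun a (v : points V) => exist V (m a (sval v)) (mV a _ (svalP v))).
Proof.
move=> mR m0 mD; split=> // [v|a b v]; apply: points_inj => /=.
  exact: m0 (svalP v).
exact: mD (svalP v).
Qed.

Variable g : {mpoly K[n]}.

(* Regular functions on (V \ {g = 0}) x A^1, with arbitrary values on g = 0. *)
Definition localized (f : points (cylinder V) -> K) : Prop :=
  exists M (h : points (cylinder V) -> K), regular h /\
    forall w, g.@[sval (cyl_fst w)] != 0 ->
      g.@[sval (cyl_fst w)] ^+ M * f w = h w.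

Lemma regular_cyl_fst (p : {mpoly K[n]}) :
  regular (fun w : points (cylinder V) => p.@[sval (cyl_fst w)]).
Proof.
apply: (algebra_meval (regular_algebra (cylinder V))) => i.
exact: regular_coord.
Qed.

Lemma localized_regular f : regular f -> localized f.
Proof. by move=> rf; exists 0, f; split=> // w _; rewrite mul1r. Qed.

Lemma localized_algebra : function_algebra localized.
Proof.
have rA := regular_algebra (cylinder V).
have rg M : regular (fun w : points (cylinder V) => g.@[sval (cyl_fst w)] ^+ M).
  by apply: (algebraX rA); apply: regular_cyl_fst.
split=> [c|f f' [M [h [rh hE]]] [M' [h' [rh' hE']]]|
         f f' [M [h [rh hE]]] [M' [h' [rh' hE']]]].
- by apply/localized_regular/(algebra_cst rA).
- exists (M + M'), (fun w => g.@[sval (cyl_fst w)] ^+ M' * h w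
                              + g.@[sval (cyl_fst w)] ^+ M * h' w); split.
    by have := rg M; have := rg M'; move=> ? ?; function_algebra rA.
  by move=> w w0; rewrite -hE // -hE' // exprD; ring.
- exists (M + M'), (fun w => h w * h' w); split; first by function_algebra rA.
  by move=> w w0; rewrite -hE // -hE' // exprD; ring.
Qed.

Lemma localized_inv : localized (fun w => g.@[sval (cyl_fst w)]^-1).
Proof.
exists 1, (fun=> 1); split; first exact: (algebra_cst (regular_algebra _)).
by move=> w w0; rewrite expr1 divff.
Qed.

(* An action on g != 0 that preserves g is slowed down by a power of g, so that it
   extends to V by the identity on g = 0. *)
Lemma Ga_action_delocalize (m : K -> ('I_n -> K) -> 'I_n -> K) :
  (forall i, localized (fun w => m (cyl_snd w) (sval (cyl_fst w)) i)) ->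
  (forall a v, V v -> g.@[v] != 0 -> V (m a v)) ->
  (forall a v, V v -> g.@[v] != 0 -> g.@[m a v] = g.@[v]) ->
  (forall v, V v -> g.@[v] != 0 -> m 0 v = v) ->
  (forall a b v, V v -> g.@[v] != 0 -> m (a + b) v = m a (m b v)) ->
  exists N mu, @Ga_action K n V mu /\
    forall a v, g.@[sval v] != 0 -> sval (mu a v) = m (g.@[sval v] ^+ N * a) (sval v).
Proof.
move=> mL mV mg m0 mD.
have {mL} mL i : exists Mp : nat * {mpoly K[n.+1]}, forall v a, V v -> g.@[v] != 0 ->
    g.@[v] ^+ Mp.1 * m a v i = Mp.2.@[snoc v a].
  have [M [h [[p hp] hE]]] := mL i; exists (M, p) => v a Vv v0 /=.
  have := hE (exist _ (snoc v a) (cylinder_snoc a Vv)).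
  rewrite hp /cyl_snd /= snoc_max.
  have -> : (fun j => snoc v a (lift ord_max j)) = v.
    by apply/funext => j; rewrite snoc_lift.
  by apply.
have {mL} [Mp MpE] := choice mL.
have {} [q qE] := choice (fun i => mpoly_snoc0 (Mp i).2).
(* The successor makes every exponent N - M_i positive, so that the displacement vanishes on g =
   0. *)
pose N := (\max_i (Mp i).1).+1.
have MN i : ((Mp i).1 < N)%N by rewrite ltnS; apply: (leq_bigmax i).
pose m' a v := if g.@[v] == 0 then v else m (g.@[v] ^+ N * a) v.
have m'V a v : V v -> V (m' a v).
  by move=> Vv; rewrite /m'; case: eqP => // /eqP v0; apply: mV.
exists N, (fun a v => exist V (m' a (sval v)) (m'V a _ (svalP v))); split; last first.
  by move=> a v v0; rewrite /= /m' (negPf v0).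
apply: Ga_action_of_raw => [i|v Vv|a b v Vv].
- have rA := regular_algebra (cylinder V).
  have rfst j : regular (fun w : points (cylinder V) => sval (cyl_fst w) j).
    exact: regular_coord.
  have rsnd : regular (fun w : points (cylinder V) => cyl_snd w).
    exact: regular_coord.
  have rg := regular_cyl_fst g.
  have rq : regular (fun w : points (cylinder V) => (q i).@[snoc (sval (cyl_fst w))
      (g.@[sval (cyl_fst w)] ^+ N * cyl_snd w)]).
    apply: (algebra_meval rA) => j.
    case: (unliftP ord_max j) => [j'|] ->.
      by under eq_fun do rewrite snoc_lift.
    by under eq_fun do rewrite snoc_max; function_algebra rA.
  (* From p(v, g^N a) = p(v, 0) + g^N a q(v, g^N a) and m 0 v = v, division by g^(M_i) leaves this
     polynomial formula, which is correct on g = 0 too. *)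
  have : regular (fun w : points (cylinder V) => sval (cyl_fst w) i +
      g.@[sval (cyl_fst w)] ^+ (N - (Mp i).1) * cyl_snd w *
      (q i).@[snoc (sval (cyl_fst w)) (g.@[sval (cyl_fst w)] ^+ N * cyl_snd w)]).
    by have := rfst i; move=> ?; function_algebra rA.
  congr regular; apply/funext => w; rewrite /m'.
  have Vv := svalP (cyl_fst w); move: (cyl_snd w) Vv => a.
  move: (sval (cyl_fst w)) => v Vv.
  have [v0|v0] := eqVneq g.@[v] 0.
    by rewrite v0 expr0n subn_eq0 leqNgt MN !mul0r addr0.
  apply: (mulfI (expf_neq0 (Mp i).1 v0)); rewrite MpE // qE -MpE // m0 //.
  rewrite mulrDr; congr (_ + _); rewrite !mulrA -exprD subnKC //; exact: ltnW.
- by rewrite /m' mulr0; case: eqP => // /eqP v0; apply: m0.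
- rewrite /m'; have [//|v0] := eqVneq g.@[v] 0; first by move=> ->; rewrite eqxx.
  (* Since g is constant along orbits, the rescaled times g^N a and g^N b add up. *)
  by rewrite !mg // (negPf v0) mulrDr mD.
Qed.

End LocalActions.

(** * Coordinates (x, y, z, t, u) on the ambient affine 5-space *)

Section Coordinates.
Variable K : numFieldType.

Definition pt5 (x y z t u : K) : 'I_5 -> K :=
  snoc (fun i : 'I_4 => nth 0 [:: x; y; z; t] i) u.

Definition on5 A (F : K -> K -> K -> K -> K -> A) (v : 'I_5 -> K) : A :=
  F (v (lift ord_max (0 : 'I_4))) (v (lift ord_max (1 : 'I_4)))
    (v (lift ord_max (2 : 'I_4))) (v (lift ord_max (3 : 'I_4))) (v ord_max).

Lemma on5_pt5 A (F : K -> K -> K -> K -> K -> A) x y z t u :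
  on5 F (pt5 x y z t u) = F x y z t u.
Proof. by rewrite /on5 /pt5 !snoc_lift snoc_max. Qed.

Lemma pt5_ind (P : ('I_5 -> K) -> Prop) :
  (forall x y z t u, P (pt5 x y z t u)) -> forall v, P v.
Proof.
move=> H v; have -> : v = on5 pt5 v; last exact: H.
rewrite [LHS]snocE /on5 /pt5; congr snoc; apply/funext => i.
by case: i => [[|[|[|[|]]]] Hi] //=; congr (v (lift _ _)); apply/val_inj.
Qed.

Lemma pt5_components W (C : (W -> K) -> Prop) (X Y Z T U : W -> K) :
  C X -> C Y -> C Z -> C T -> C U ->
  forall i, C (fun w => pt5 (X w) (Y w) (Z w) (T w) (U w) i).
Proof.
move=> CX CY CZ CT CU i; case: (unliftP ord_max i) => [j|] ->.
  by under eq_fun do rewrite /pt5 snoc_lift; case: j => [[|[|[|[|]]]]].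
by under eq_fun do rewrite /pt5 snoc_max.
Qed.

Lemma koras_russell_pt5 d k l x y z t u :
  cylinder (koras_russell K d k l) (pt5 x y z t u) <->
  x ^+ d * z = y ^+ l + x - t ^+ k.
Proof. by rewrite /cylinder /koras_russell /= /pt5 !snoc_lift. Qed.

End Coordinates.

(** Comparison of the coefficients of ['X]; the error term starts at degree d+2 and does not
    contribute. *)
Lemma poly_root_mod_at0 (K : numFieldType) n d (U1 P1 Q E : {poly K}) :
  (1 + 'X * Q) ^+ n.+1 * (1 + 'X * U1) = 1 + 'X * P1 + 'X^(d.+2) * E ->
  n.+1%:R * Q.[0] + U1.[0] = P1.[0].
Proof.
pose B := pow_quot n.+1 (1 + 'X * Q) 1.
have -> : (1 + 'X * Q) ^+ n.+1 = 1 + 'X * Q * B.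
  have := pow_quotE n.+1 (1 + 'X * Q) 1.
  by rewrite expr1n addrAC subrr add0r => <-; ring.
move=> H; have {H} : Q * B + U1 + 'X * Q * B * U1 = P1 + 'X^(d.+1) * E.
  apply: (mulfI (monic_neq0 (monicX K))); apply: (addrI 1).
  transitivity ((1 + 'X * Q * B) * (1 + 'X * U1)); first by ring.
  by rewrite H [in LHS]exprS; ring.
move=> /(congr1 (horner^~ 0)); rewrite !hornerE horner_pow_quot !hornerE.
by rewrite pow_quotxx expr1n mulr1 expr0n mul0r addr0 mulrC.
Qed.

(** * Comparison of the two cylinders over t <> 0 *)

(* The exponents d and l of the surface are here d.+2 and l.+1; T and S stand for
   t^k and t^(-k). The maps phi, from (x, y, z, t, u) to (x, y1, Z, t, w), and psi,
   back, are mutually inverse. approx_root is the root F of T - x modulo x^(d+2). *)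
Section Charts.
Variables (K : numFieldType) (d l : nat) (a1 a2 b1 b2 : {poly K}).
Hypothesis aE :
  (1 + 'X * a1) ^+ l.+1 = 1 - 'X + 'X^(d.+2) * a2.
Hypothesis bE :
  (1 + 'X * b1) ^+ l.+1 * (1 + 'X) = 1 + 'X^(d.+2) * b2.
Implicit Types x y z u w Z T S : K.

Definition root_cofactor x Z S :=
  S * (a1.[x * S] + Z * b1.[x * Z * S]
       + x * S * a1.[x * S] * Z * b1.[x * Z * S]).

Definition approx_root x y1 Z S := y1 * (1 + x * root_cofactor x Z S).

Definition root_error x Z T S :=
  T * S ^+ d.+2 * ((1 - x * S) * Z ^+ d.+2 * b2.[x * Z * S]
    + a2.[x * S] * (1 + (x * Z * S) ^+ d.+2 * b2.[x * Z * S])).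

Definition psi_y x y1 Z w S := approx_root x y1 Z S + x ^+ d.+2 * w.
Definition psi_u x y1 Z w S := y1 * root_cofactor x Z S + x ^+ d.+1 * w.
Definition psi_z x y1 Z w T S :=
  w * pow_quot l.+1 (psi_y x y1 Z w S) (approx_root x y1 Z S)
  + root_error x Z T S.

Definition phi_y x y u := y - x * u.
(** The quotient (y1^(l+1) - T) / x: the surface equation turns (y^(l+1) - T) / x into x^(d+1) z -
    1, and the last term corrects y to y1. *)
Definition phi_Z x y z u :=
  x ^+ d.+1 * z - 1 - u * pow_quot l.+1 (phi_y x y u) y.
Definition phi_root x y z u S :=
  approx_root x (phi_y x y u) (phi_Z x y z u) S.
Definition phi_e x y z u S :=
  S * (x ^+ d.+1 * z - 1
    - (u - phi_y x y u * root_cofactor x (phi_Z x y z u) S)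
      * (\sum_(i < l.+1) y ^+ (l - i) * pow_quot i y (phi_root x y z u S))
      * y / l.+1%:R).
(* (y - F) / x^(d+2) without division: by phi_eE, y * S / l.+1%:R inverts
   (y^(l+1) - F^(l+1)) / (y - F) up to 1 + x e, and the geometric series inverts
   1 + x e modulo x^(d+2). *)
Definition phi_w x y z u T S :=
  (z - root_error x (phi_Z x y z u) T S)
    * (y * S / l.+1%:R * pow_quot d.+2 1 (- (x * phi_e x y z u S)))
  + (- phi_e x y z u S) ^+ d.+2 * (y - phi_root x y z u S).

(** [approx_root] is y1 times approximate (l+1)-th roots of 1 - x S and of 1 / (1 + x Z S). Since
    y1^(l+1) = T (1 + x Z S), its power is T (1 - x S) = T - x up to order d+2. *)
Lemma approx_rootE x y1 Z T S : T * S = 1 -> x * Z = y1 ^+ l.+1 - T ->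
  approx_root x y1 Z S ^+ l.+1 = T - x + x ^+ d.+2 * root_error x Z T S.
Proof.
move=> TS xZ.
have -> : approx_root x y1 Z S =
  y1 * (1 + x * S * a1.[x * S]) * (1 + x * Z * S * b1.[x * Z * S]).
  rewrite /approx_root /root_cofactor; ring.
have aS := congr1 (horner^~ (x * S)) aE.
have bS := congr1 (horner^~ (x * Z * S)) bE.
rewrite !hornerE in aS bS.
rewrite exprMn exprMn aS.
have -> : y1 ^+ l.+1 = T * (1 + x * Z * S).
  by rewrite mulrDr mulr1 mulrCA TS mulr1 xZ addrC subrK.
have -> : T - x = T * (1 - x * S) by rewrite mulrBr mulr1 mulrCA TS mulr1.
move: bS; move: ((1 + _ * b1.[_]) ^+ _) => b bS.
transitivity (T * (1 - x * S + (x * S) ^+ d.+2 * a2.[x * S])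
              * (b * (1 + x * Z * S))); first by ring.
by rewrite bS /root_error !exprMn; ring.
Qed.

(** With F the approximate root, y - F = x^(d+2) w makes y^(l+1) - F^(l+1) divisible by x^(d+2), and
    F^(l+1) + x - T is x^(d+2) times the error. [psi_z] adds the two quotients. *)
Lemma psi_surface x y1 Z w T S : T * S = 1 -> x * Z = y1 ^+ l.+1 - T ->
  x ^+ d.+2 * psi_z x y1 Z w T S = psi_y x y1 Z w S ^+ l.+1 + x - T.
Proof.
move=> TS xZ; rewrite mulrDr mulrA.
have yF : psi_y x y1 Z w S - approx_root x y1 Z S = x ^+ d.+2 * w.
  by rewrite /psi_y addrAC subrr add0r.
rewrite -yF -pow_quotE (approx_rootE TS xZ); ring.
Qed.

Lemma psi_uE x y1 Z w S : x * psi_u x y1 Z w S = psi_y x y1 Z w S - y1.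
Proof. rewrite /psi_u /psi_y /approx_root !exprS; ring. Qed.

Lemma phi_model x y z u T : x ^+ d.+2 * z = y ^+ l.+1 + x - T ->
  x * phi_Z x y z u = phi_y x y u ^+ l.+1 - T.
Proof.
move=> xz; have yy : phi_y x y u - y = - (x * u) by rewrite /phi_y; ring.
have := pow_quotE l.+1 (phi_y x y u) y; rewrite yy => /(canRL (subrK _)) ->.
move: xz; rewrite exprS -mulrA /phi_Z; move: (x ^+ d.+1 * z) => c xc.
by rewrite !mulrBr xc; ring.
Qed.

Lemma phi_rootE x y z u S : phi_root x y z u S =
  y - x * (u - phi_y x y u * root_cofactor x (phi_Z x y z u) S).
Proof.
rewrite /phi_root /approx_root {1}/phi_y; move: (root_cofactor _ _ _) => c.
by rewrite /phi_y; ring.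
Qed.

(** Modulo x, y and F agree, so the power quotient is (l+1) y^l, and y^(l+1) S is 1 since y^(l+1) =
    T. The multiples of x left over are collected in e. *)
Lemma phi_eE x y z u T S : T * S = 1 -> x ^+ d.+2 * z = y ^+ l.+1 + x - T ->
  pow_quot l.+1 y (phi_root x y z u S) * (y * S / l.+1%:R)
  = 1 + x * phi_e x y z u S.
Proof.
move=> TS xz; set F := phi_root x y z u S.
pose v := u - phi_y x y u * root_cofactor x (phi_Z x y z u) S.
pose A := \sum_(i < l.+1) y ^+ (l - i) * pow_quot i y F.
have yF : y - F = x * v by rewrite /F phi_rootE opprB addrC subrK.
have -> : pow_quot l.+1 y F = l.+1%:R * y ^+ l - x * v * A.
  rewrite -[l in RHS]/(l.+1.-1) -pow_quotxx /pow_quot /A mulr_sumr -sumrB.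
  apply: eq_bigr => i _; rewrite mulrCA -yF -pow_quotE; ring.
have l0 : l.+1%:R != 0 :> K by rewrite pnatr_eq0.
have yS : y ^+ l.+1 * S = 1 + x * S * (x ^+ d.+1 * z - 1).
  have -> : y ^+ l.+1 = x * (x ^+ d.+1 * z) - x + T.
    by rewrite mulrA -exprS xz; ring.
  by rewrite mulrDl TS; ring.
rewrite /phi_e -/F -/v -/A; move: (l.+1%:R) l0 => N N0.
transitivity (y ^+ l.+1 * S - x * v * A * y * S / N).
  by rewrite exprS; field.
by rewrite yS; field.
Qed.

(** The geometric sum G satisfies (1 + x e) G = 1 - (-x e)^(d+2). The second summand of [phi_w]
    restores the missing term, because x^(d+2) (z - B) = (y - F) Q. *)
Lemma phi_w_quot x y z u T S : T * S = 1 -> x ^+ d.+2 * z = y ^+ l.+1 + x - T ->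
  phi_w x y z u T S * pow_quot l.+1 y (phi_root x y z u S)
  = z - root_error x (phi_Z x y z u) T S.
Proof.
move=> TS xz; rewrite /phi_w.
have FE : phi_root x y z u S ^+ l.+1 = _ := approx_rootE TS (phi_model u xz).
have yF := pow_quotE l.+1 y (phi_root x y z u S).
have eE := phi_eE u TS xz.
move: FE yF eE.
set F := phi_root _ _ _ _ _; set e := phi_e _ _ _ _ _; set B := root_error _ _ _ _.
set Q := pow_quot l.+1 _ _; set G := pow_quot _ _ _ => FE yF eE.
have GE : (1 + x * e) * G = 1 - (- (x * e)) ^+ d.+2.
  by have := pow_quotE d.+2 1 (- (x * e)); rewrite expr1n opprK => <-.
rewrite mulrDl.
have -> : (z - B) * (y * S / l.+1%:R * G) * Q = (z - B) * ((1 + x * e) * G).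
  by rewrite -eE; ring.
rewrite GE -mulrA -yF FE.
have -> : y ^+ l.+1 - (T - x + x ^+ d.+2 * B) = x ^+ d.+2 * (z - B).
  by rewrite mulrBr xz; ring.
by rewrite -[- (x * e)]mulrN exprMn; ring.
Qed.

(** Same computation with x^(d+2) in place of Q. This identity determines w off x = 0, and the
    preceding one where the power quotient is nonzero. *)
Lemma phi_w_root x y z u T S : T * S = 1 -> x ^+ d.+2 * z = y ^+ l.+1 + x - T ->
  x ^+ d.+2 * phi_w x y z u T S = y - phi_root x y z u S.
Proof.
move=> TS xz; rewrite /phi_w.
have FE : phi_root x y z u S ^+ l.+1 = _ := approx_rootE TS (phi_model u xz).
have yF := pow_quotE l.+1 y (phi_root x y z u S).
have eE := phi_eE u TS xz.
move: FE yF eE.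
set F := phi_root _ _ _ _ _; set e := phi_e _ _ _ _ _; set B := root_error _ _ _ _.
set Q := pow_quot l.+1 _ _; set G := pow_quot _ _ _ => FE yF eE.
have GE : (1 + x * e) * G = 1 - (- (x * e)) ^+ d.+2.
  by have := pow_quotE d.+2 1 (- (x * e)); rewrite expr1n opprK => <-.
have zB : x ^+ d.+2 * (z - B) = (y - F) * Q by rewrite -yF FE mulrBr xz; ring.
rewrite mulrDr mulrA zB.
have -> : (y - F) * Q * (y * S / l.+1%:R * G) = (y - F) * ((1 + x * e) * G).
  by rewrite -eE; ring.
by rewrite GE -[- (x * e)]mulrN exprMn; ring.
Qed.

(** Both (1 - X)^(1/(l+1)) and (1 + X)^(-1/(l+1)) have linear coefficient -1/(l+1). The value serves
    on x = 0, where x cannot be cancelled. *)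
Lemma root_cofactor_at0 Z S :
  l.+1%:R * root_cofactor 0 Z S = - (S * (1 + Z)).
Proof.
have a0 : l.+1%:R * a1.[0] = -1.
  have aE' : (1 + 'X * a1) ^+ l.+1 * (1 + 'X * 0) = 1 + 'X * -1 + 'X^(d.+2) * a2.
    by rewrite aE; ring.
  by have := poly_root_mod_at0 aE'; rewrite !hornerE.
have b0 : l.+1%:R * b1.[0] = -1.
  have bE' : (1 + 'X * b1) ^+ l.+1 * (1 + 'X * 1) = 1 + 'X * 0 + 'X^(d.+2) * b2.
    by rewrite mulr1 bE; ring.
  by have /(canRL (addrK _)) := poly_root_mod_at0 bE'; rewrite !hornerE.
rewrite /root_cofactor !mul0r addr0 mulrCA mulrDr [_ * (Z * _)]mulrCA a0 b0; ring.
Qed.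

Section PhiThenPsi.
Variables x y z u T S : K.
Hypotheses (TS : T * S = 1) (xz : x ^+ d.+2 * z = y ^+ l.+1 + x - T).

Lemma psi_phi_y : psi_y x (phi_y x y u) (phi_Z x y z u) (phi_w x y z u T S) S = y.
Proof. by rewrite /psi_y phi_w_root // addrC subrK. Qed.

Lemma psi_phi_z :
  psi_z x (phi_y x y u) (phi_Z x y z u) (phi_w x y z u T S) T S = z.
Proof. by rewrite /psi_z psi_phi_y phi_w_quot // subrK. Qed.

Lemma psi_phi_u : psi_u x (phi_y x y u) (phi_Z x y z u) (phi_w x y z u T S) S = u.
Proof.
have [x0|x0] := eqVneq x 0; last first.
  by apply: (mulfI x0); rewrite psi_uE psi_phi_y /phi_y opprB addrC subrK.
have l0 : l.+1%:R != 0 :> K by rewrite pnatr_eq0.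
(* On x = 0, Z = -1 - (l+1) u y^l and T = y^(l+1), so the formula for u collapses to u T S = u. *)
apply: (mulfI l0); rewrite /psi_u /phi_Z /phi_y x0 !exprS !mul0r !subr0 addr0.
rewrite mulrCA root_cofactor_at0 sub0r pow_quotxx /=.
have yT : y ^+ l.+1 = T.
  by move: xz; rewrite x0 exprS !mul0r addr0 => /esym/subr0_eq.
by rewrite -[RHS]mul1r -TS -yT exprS; ring.
Qed.

End PhiThenPsi.

Section PsiThenPhi.
Variables x y1 Z w T S : K.
Hypotheses (TS : T * S = 1) (xZ : x * Z = y1 ^+ l.+1 - T).
Let y := psi_y x y1 Z w S.
Let z := psi_z x y1 Z w T S.
Let u := psi_u x y1 Z w S.

Lemma phi_psi_y : phi_y x y u = y1.
Proof. by rewrite /phi_y psi_uE opprB addrC subrK. Qed.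

Lemma phi_psi_Z : phi_Z x y z u = Z.
Proof.
have [x0|x0] := eqVneq x 0; last first.
  apply: (mulfI x0); rewrite xZ -phi_psi_y; apply: phi_model.
  exact: psi_surface.
have yT : y1 ^+ l.+1 = T by move: xZ; rewrite x0 mul0r => /esym/subr0_eq.
rewrite /phi_Z phi_psi_y /u /y /psi_u /psi_y /approx_root x0 !exprS !mul0r.
rewrite !addr0 mulr1 sub0r pow_quotxx /=.
transitivity (-1 - y1 ^+ l.+1 * (l.+1%:R * root_cofactor 0 Z S)).
  by rewrite exprS; ring.
by rewrite root_cofactor_at0 yT mulrN mulrA TS; ring.
Qed.

Lemma phi_psi_w : phi_w x y z u T S = w.
Proof.
have xz : x ^+ d.+2 * z = y ^+ l.+1 + x - T by apply: psi_surface.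
have FE : phi_root x y z u S = approx_root x y1 Z S.
  by rewrite /phi_root phi_psi_y phi_psi_Z.
have [x0|x0] := eqVneq x 0; last first.
  apply: (mulfI (expf_neq0 d.+2 x0)); rewrite phi_w_root // FE.
  by rewrite /y /psi_y addrAC subrr add0r.
have yT : y1 ^+ l.+1 = T by move: xZ; rewrite x0 mul0r => /esym/subr0_eq.
(* At x = 0 this is (l+1) y1^l, and y1 is nonzero because y1^(l+1) = T is. *)
have Q0 : pow_quot l.+1 y (approx_root x y1 Z S) != 0.
  rewrite /y /psi_y /approx_root x0 exprS !mul0r !addr0 mulr1 pow_quotxx.
  rewrite mulf_neq0 ?pnatr_eq0 ?expf_neq0 //; apply: contra_eq_neq TS => y0.
  by rewrite -yT y0 exprS !mul0r eq_sym oner_eq0.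
apply: (mulIf Q0); rewrite -{1}FE phi_w_quot // phi_psi_Z.
by rewrite /z /psi_z addrK.
Qed.

End PsiThenPhi.

(** * The chart formulas stay inside a function algebra *)

Section ChartAlgebra.
Variables (W : Type) (C : (W -> K) -> Prop).
Hypothesis algC : function_algebra C.

Section Psi.
Variables (x y1 Z w T S : W -> K).
Hypotheses (Cx : C x) (Cy1 : C y1) (CZ : C Z) (Cw : C w) (CT : C T) (CS : C S).

Lemma algebra_root_cofactor : C (fun v => root_cofactor (x v) (Z v) (S v)).
Proof. rewrite /root_cofactor; function_algebra algC. Qed.

Lemma algebra_approx_root : C (fun v => approx_root (x v) (y1 v) (Z v) (S v)).
Proof.
have := algebra_root_cofactor; rewrite /approx_root => ?.
by function_algebra algC.
Qed.

Lemma algebra_root_error : C (fun v => root_error (x v) (Z v) (T v) (S v)).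
Proof. rewrite /root_error; function_algebra algC. Qed.

Lemma algebra_psi_y : C (fun v => psi_y (x v) (y1 v) (Z v) (w v) (S v)).
Proof. have := algebra_approx_root; rewrite /psi_y => ?; function_algebra algC. Qed.

Lemma algebra_psi_u : C (fun v => psi_u (x v) (y1 v) (Z v) (w v) (S v)).
Proof. have := algebra_root_cofactor; rewrite /psi_u => ?; function_algebra algC. Qed.

Lemma algebra_psi_z :
  C (fun v => psi_z (x v) (y1 v) (Z v) (w v) (T v) (S v)).
Proof.
have := algebra_psi_y; have := algebra_approx_root.
have := algebra_root_error; rewrite /psi_z => ? ? ?; function_algebra algC.
Qed.

End Psi.

Section Phi.
Variables (x y z u T S : W -> K).
Hypotheses (Cx : C x) (Cy : C y) (Cz : C z) (Cu : C u) (CT : C T) (CS : C S).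

Lemma algebra_phi_y : C (fun v => phi_y (x v) (y v) (u v)).
Proof. rewrite /phi_y; function_algebra algC. Qed.

Lemma algebra_phi_Z : C (fun v => phi_Z (x v) (y v) (z v) (u v)).
Proof.
have := algebra_phi_y; rewrite /phi_Z => ?; function_algebra algC.
Qed.

Lemma algebra_phi_w :
  C (fun v => phi_w (x v) (y v) (z v) (u v) (T v) (S v)).
Proof.
have Cy1 := algebra_phi_y; have CZ := algebra_phi_Z.
have Cc := algebra_root_cofactor Cx CZ CS.
have CF := algebra_approx_root Cx Cy1 CZ CS.
have CB := algebra_root_error Cx CZ CT CS.
rewrite /phi_w /phi_e /phi_root; function_algebra algC.
Qed.

End Phi.

End ChartAlgebra.


(** * The flow of D and its transport to X x A^1 *)

Section Flow.
Variable k : nat.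
Let V := cylinder (koras_russell K d.+2 k l.+1).

(** The x-coordinate of exp(a D); on Y it equals ((y1 + a Z)^(l+1) - T) / Z when Z != 0. *)
Definition flow_x a x y1 Z := x + pow_shift l.+1 y1 a Z.

Lemma flow_xD a b x y1 Z :
  flow_x (a + b) x y1 Z = flow_x a (flow_x b x y1 Z) (y1 + b * Z) Z.
Proof. by rewrite /flow_x pow_shiftD addrA. Qed.

Lemma flow_model a x y1 Z T :
  x * Z = y1 ^+ l.+1 - T -> flow_x a x y1 Z * Z = (y1 + a * Z) ^+ l.+1 - T.
Proof. by move=> xZ; rewrite mulrDl xZ [_ * Z]mulrC pow_shiftE; ring. Qed.

Definition psi5 x y1 Z w t :=
  let T := t ^+ k in
  pt5 x (psi_y x y1 Z w T^-1) (psi_z x y1 Z w T T^-1) t (psi_u x y1 Z w T^-1).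

Definition chart_flow a := on5 (fun x y z t u =>
  let y1 := phi_y x y u in let Z := phi_Z x y z u in
  psi5 (flow_x a x y1 Z) (y1 + a * Z) Z
    (phi_w x y z u (t ^+ k) (t ^+ k)^-1) t).

Lemma psi5_mem x y1 Z w t : t != 0 -> x * Z = y1 ^+ l.+1 - t ^+ k ->
  V (psi5 x y1 Z w t).
Proof.
move=> t0 xZ; apply/koras_russell_pt5; apply: psi_surface => //.
by rewrite divff ?expf_neq0.
Qed.

Lemma psi5_phi x y z t u : t != 0 -> V (pt5 x y z t u) ->
  pt5 x y z t u = psi5 x (phi_y x y u) (phi_Z x y z u)
    (phi_w x y z u (t ^+ k) (t ^+ k)^-1) t /\
  x * phi_Z x y z u = phi_y x y u ^+ l.+1 - t ^+ k.
Proof.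
move=> t0 /koras_russell_pt5 xz; split; last exact: phi_model.
have TS : t ^+ k * (t ^+ k)^-1 = 1 by rewrite divff ?expf_neq0.
by rewrite /psi5 psi_phi_y ?psi_phi_z ?psi_phi_u.
Qed.

Lemma chart_flow_psi5 a x y1 Z w t : t != 0 -> x * Z = y1 ^+ l.+1 - t ^+ k ->
  chart_flow a (psi5 x y1 Z w t) =
  psi5 (flow_x a x y1 Z) (y1 + a * Z) Z w t.
Proof.
move=> t0 xZ; have TS : t ^+ k * (t ^+ k)^-1 = 1 by rewrite divff ?expf_neq0.
rewrite /chart_flow [X in on5 _ X]/psi5 on5_pt5.
by rewrite phi_psi_y (phi_psi_Z _ TS) ?(phi_psi_w _ TS).
Qed.

(** The flow keeps t, hence it extends over t = 0 once slowed down by a power of t. Its description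
    in the chart (x, y1, Z, w, t) is what the invariance argument evaluates. *)
Lemma chart_flow_action :
  exists N mu, @Ga_action K 5 V mu /\
    forall a x y1 Z w t (v : points V), t != 0 -> x * Z = y1 ^+ l.+1 - t ^+ k ->
      sval v = psi5 x y1 Z w t -> let b := t ^+ N * a in
      sval (mu a v) = psi5 (flow_x b x y1 Z) (y1 + b * Z) Z w t.
Proof.
pose g : {mpoly K[5]} := 'X_(lift ord_max (3 : 'I_4)).
have gE x y z t u : g.@[pt5 x y z t u] = t by rewrite mevalXU /pt5 snoc_lift.
have chart v : V v -> g.@[v] != 0 -> exists x y1 Z w,
    v = psi5 x y1 Z w g.@[v] /\ x * Z = y1 ^+ l.+1 - g.@[v] ^+ k.
  elim/pt5_ind: v => x y z t u Vv; rewrite gE => t0.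
  by have [] := psi5_phi t0 Vv; do 4!eexists; split; eassumption.
have flowE v : V v -> g.@[v] != 0 -> exists x y1 Z w,
    [/\ v = psi5 x y1 Z w g.@[v], x * Z = y1 ^+ l.+1 - g.@[v] ^+ k &
     forall a, chart_flow a v = psi5 (flow_x a x y1 Z) (y1 + a * Z) Z w g.@[v]].
  move=> Vv v0; have [x [y1 [Z [w [vE xZ]]]]] := chart v Vv v0.
  by exists x, y1, Z, w; split=> // b; rewrite {1}vE chart_flow_psi5.
have [|||||N [mu [mu_act muE]]] := @Ga_action_delocalize K 5 V g chart_flow _.
- have lA := localized_algebra V g.
  have lcoord j : localized g (fun w : points (cylinder V) => sval (cyl_fst w) j).
    by apply/localized_regular/regular_coord.
  have la : localized g (fun w : points (cylinder V) => cyl_snd w).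
    by apply/localized_regular/regular_coord.
  have lx := lcoord (lift ord_max (0 : 'I_4)).
  have ly := lcoord (lift ord_max (1 : 'I_4)).
  have lz := lcoord (lift ord_max (2 : 'I_4)).
  have lt := lcoord (lift ord_max (3 : 'I_4)).
  have lu := lcoord ord_max.
  have lT : localized g (fun w : points (cylinder V) =>
      sval (cyl_fst w) (lift ord_max (3 : 'I_4)) ^+ k) by function_algebra lA.
  have lS : localized g (fun w : points (cylinder V) =>
      (sval (cyl_fst w) (lift ord_max (3 : 'I_4)) ^+ k)^-1).
    have := algebraX lA k (localized_inv V g); congr localized.
    by apply/funext => w; rewrite mevalXU exprVn.
  have ly1 := algebra_phi_y lA lx ly lu.
  have lZ := algebra_phi_Z lA lx ly lz lu.
  have lw := algebra_phi_w lA lx ly lz lu lT lS.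
  have ly1' := algebraD lA ly1 (algebraM lA la lZ).
  have lx' := algebraD lA lx (algebraM lA la (algebra_pow_quot lA l.+1 ly1' ly1)).
  move=> i; rewrite /chart_flow /on5 /psi5; apply: pt5_components => //.
  + exact: (algebra_psi_y lA lx' ly1' lZ lw lS).
  + exact: (algebra_psi_z lA lx' ly1' lZ lw lT lS).
  + exact: (algebra_psi_u lA lx' ly1' lZ lw lS).
- move=> a v Vv v0; have [x [y1 [Z [w [_ xZ ->]]]]] := flowE v Vv v0.
  by apply: psi5_mem => //; apply: flow_model.
- by move=> a v Vv v0; have [x [y1 [Z [w [_ xZ ->]]]]] := flowE v Vv v0; rewrite gE.
- move=> v Vv v0; have [x [y1 [Z [w [vE xZ ->]]]]] := flowE v Vv v0.
  by rewrite /flow_x /pow_shift !mul0r !addr0 -vE.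
- move=> a b v Vv v0; have [x [y1 [Z [w [vE xZ E]]]]] := flowE v Vv v0.
  rewrite !E chart_flow_psi5 //; last exact: flow_model.
  by rewrite flow_xD mulrDl addrA [y1 + _ + _]addrAC.
exists N, mu; split=> // a x y1 Z w t v t0 xZ vE /=.
by rewrite muE vE gE // chart_flow_psi5.
Qed.

End Flow.

End Charts.

(** * Invariant functions are constant *)

Section TriangularActions.
Variables (K : numFieldType) (d k l : nat).
Let V := cylinder (koras_russell K d k l).

Lemma pt5_action (X Y Z T U : K -> K -> K -> K -> K -> K -> K) :
  let m a := on5 (fun x y z t u => pt5 (X a x y z t u) (Y a x y z t u)
    (Z a x y z t u) (T a x y z t u) (U a x y z t u)) in
  (forall W (C : (W -> K) -> Prop) a x y z t u, function_algebra C ->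
    C a -> C x -> C y -> C z -> C t -> C u ->
    [/\ C (fun w => X (a w) (x w) (y w) (z w) (t w) (u w)),
        C (fun w => Y (a w) (x w) (y w) (z w) (t w) (u w)),
        C (fun w => Z (a w) (x w) (y w) (z w) (t w) (u w)),
        C (fun w => T (a w) (x w) (y w) (z w) (t w) (u w)) &
        C (fun w => U (a w) (x w) (y w) (z w) (t w) (u w))]) ->
  (forall a v, V v -> V (m a v)) -> (forall v, m 0 v = v) ->
  (forall a b v, m (a + b) v = m a (m b v)) ->
  exists2 mu, @Ga_action K 5 V mu & forall a v, sval (mu a v) = m a (sval v).
Proof.
move=> m mC mV m0 mD; exists (fun a v => exist V (m a (sval v)) (mV a _ (svalP v))) => //.
apply: Ga_action_of_raw => // i.
have r j : regular (fun w : points (cylinder V) => sval (cyl_fst w) j).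
  exact: regular_coord.
have rsnd : regular (fun w : points (cylinder V) => cyl_snd w).
  exact: regular_coord.
have [] := mC _ _ _ _ _ _ _ _ (regular_algebra (cylinder V)) rsnd
  (r (lift ord_max (0 : 'I_4))) (r (lift ord_max (1 : 'I_4)))
  (r (lift ord_max (2 : 'I_4))) (r (lift ord_max (3 : 'I_4))) (r ord_max).
by move=> *; apply: pt5_components.
Qed.

Lemma shift_u_action : exists2 mu, @Ga_action K 5 V mu &
  forall a v, sval (mu a v) = on5 (fun x y z t u => pt5 x y z t (u + a)) (sval v).
Proof.
apply: (pt5_action (X := fun _ x _ _ _ _ => x) (Y := fun _ _ y _ _ _ => y)
  (Z := fun _ _ _ z _ _ => z) (T := fun _ _ _ _ t _ => t)
  (U := fun a _ _ _ _ u => u + a)) => /= [W C a x y z t u algC|a|v|a b].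
- by move=> *; split=> //; function_algebra algC.
- elim/pt5_ind => x y z t u; rewrite on5_pt5 => /koras_russell_pt5 ?.
  exact/koras_russell_pt5.
- by elim/pt5_ind: v => x y z t u; rewrite on5_pt5 addr0.
- by elim/pt5_ind => x y z t u; rewrite !on5_pt5 addrA addrAC.
Qed.

Lemma shift_y_action : exists2 mu, @Ga_action K 5 V mu &
  forall a v, sval (mu a v) = on5 (fun x y z t u =>
    pt5 x (y + a * x ^+ d) (z + pow_shift l y a (x ^+ d)) t u) (sval v).
Proof.
apply: (pt5_action (X := fun _ x _ _ _ _ => x) (Y := fun a x y _ _ _ => y + a * x ^+ d)
  (Z := fun a x y z _ _ => z + pow_shift l y a (x ^+ d)) (T := fun _ _ _ _ t _ => t)
  (U := fun a _ _ _ _ u => u)) => /= [W C a x y z t u algC|a|v|a b].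
- by move=> *; split=> //; rewrite /pow_shift; function_algebra algC.
- elim/pt5_ind => x y z t u; rewrite on5_pt5 => /koras_russell_pt5 xz.
  by apply/koras_russell_pt5; rewrite mulrDr pow_shiftE xz; ring.
- by elim/pt5_ind: v => x y z t u; rewrite on5_pt5 /pow_shift !mul0r !addr0.
- elim/pt5_ind => x y z t u; rewrite !on5_pt5 pow_shiftD mulrDl.
  by rewrite [a * _ + _]addrC !addrA.
Qed.

Lemma shift_t_action : exists2 mu, @Ga_action K 5 V mu &
  forall a v, sval (mu a v) = on5 (fun x y z t u =>
    pt5 x y (z - pow_shift k t a (x ^+ d)) (t + a * x ^+ d) u) (sval v).
Proof.
apply: (pt5_action (X := fun _ x _ _ _ _ => x) (Y := fun _ _ y _ _ _ => y)
  (Z := fun a x _ z t _ => z - pow_shift k t a (x ^+ d))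
  (T := fun a x _ _ t _ => t + a * x ^+ d)
  (U := fun a _ _ _ _ u => u)) => /= [W C a x y z t u algC|a|v|a b].
- by move=> *; split=> //; rewrite /pow_shift; function_algebra algC.
- elim/pt5_ind => x y z t u; rewrite on5_pt5 => /koras_russell_pt5 xz.
  by apply/koras_russell_pt5; rewrite mulrBr pow_shiftE xz; ring.
- by elim/pt5_ind: v => x y z t u; rewrite on5_pt5 /pow_shift !mul0r subr0 !addr0.
- elim/pt5_ind => x y z t u; rewrite !on5_pt5 pow_shiftD mulrDl opprD.
  by rewrite [a * _ + _]addrC !addrA.
Qed.

End TriangularActions.

(** In characteristic 0, the integers 1, 2, 3, ... give more distinct roots of q - c than its degree
    allows, so q = c. *)
Lemma horner_const_at0 (K : numFieldType) (q : {poly K}) c :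
  (forall s, s != 0 -> q.[s] = c) -> q.[0] = c.
Proof.
move=> qc; suff : q - c%:P == 0 by rewrite subr_eq0 => /eqP ->; rewrite hornerC.
apply/eqP/(@roots_geq_poly_eq0 _ _ [seq i.+1%:R | i <- iota 0 (size (q - c%:P))]).
- by apply/allP => _ /mapP[i _ ->]; rewrite rootE !hornerE qc ?subrr ?pnatr_eq0.
- rewrite map_inj_uniq ?iota_uniq // => i j /eqP.
  by rewrite eqr_nat => /eqP[].
- by rewrite size_map size_iota.
Qed.

Lemma ML_cylinder_koras_russell (K : numFieldType) d k l (f : _ -> K) :
  (0 < k)%N -> ML (cylinder (koras_russell K d.+2 k l.+1)) f ->
  exists c, f = fun=> c.
Proof.
move=> k0 [[P fP] fI]; pose V := cylinder (koras_russell K d.+2 k l.+1).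
have inv mu : Ga_action mu -> forall a (v : points V), P.@[sval (mu a v)] = P.@[sval v].
  by move=> muA a v; rewrite -!fP fI.
(* Approximate roots of 1 - X and of 1 / (1 + X), with errors of order d+2. *)
have [[Q1 [E1 aE]] [Q2 [E2 bE]]] :=
  (poly_root_mod l 0 (-1 : {poly K}) d.+1, poly_root_mod l (1 : {poly K}) 0 d.+1).
rewrite mulr0 addr0 mulr1 mulrN1 in aE; rewrite mulr1 mulr0 addr0 in bE.
have inv_u x y z t u u' : V (pt5 x y z t u) -> P.@[pt5 x y z t u] = P.@[pt5 x y z t u'].
  move=> Vv; have [mu muA muE] := shift_u_action K d.+2 k l.+1.
  have := inv mu muA (u' - u) (exist _ _ Vv); rewrite muE on5_pt5.
  by rewrite addrC subrK => <-.
have inv_y x y z t u y' z' : x != 0 ->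
    V (pt5 x y z t u) -> V (pt5 x y' z' t u) -> P.@[pt5 x y z t u] = P.@[pt5 x y' z' t u].
  move=> x0 Vv Vv'; have [mu muA muE] := shift_y_action K d.+2 k l.+1.
  (* This time carries y to y'; the value z' is then forced by the equation, as x != 0. *)
  pose a := (y' - y) / x ^+ d.+2.
  have := inv mu muA a (exist _ _ Vv).
  have := svalP (mu a (exist _ _ Vv)); rewrite muE on5_pt5.
  have xd : x ^+ d.+2 != 0 by apply: expf_neq0.
  rewrite /a divfK // [_ + (_ - _)]addrC subrK => Va <-; congr (P.@[pt5 _ _ _ _ _]).
  apply: (mulfI xd); move: Va Vv' => /koras_russell_pt5 -> /koras_russell_pt5 ->.
  by [].
have inv_t x y z t u z' t' : x != 0 ->
    V (pt5 x y z t u) -> V (pt5 x y z' t' u) -> P.@[pt5 x y z t u] = P.@[pt5 x y z' t' u].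
  move=> x0 Vv Vv'; have [mu muA muE] := shift_t_action K d.+2 k l.+1.
  pose a := (t' - t) / x ^+ d.+2.
  have := inv mu muA a (exist _ _ Vv).
  have := svalP (mu a (exist _ _ Vv)); rewrite muE on5_pt5.
  have xd : x ^+ d.+2 != 0 by apply: expf_neq0.
  rewrite /a divfK // [_ + (_ - _)]addrC subrK => Va <-; congr (P.@[pt5 _ _ _ _ _]).
  apply: (mulfI xd); move: Va Vv' => /koras_russell_pt5 -> /koras_russell_pt5 ->.
  by [].
have inv_x x y z t u y' z' t' u' : x != 0 ->
    V (pt5 x y z t u) -> V (pt5 x y' z' t' u') ->
    P.@[pt5 x y z t u] = P.@[pt5 x y' z' t' u'].
  move=> x0 Vv Vv'.
  (* Intermediate point: y is moved first, then u, then t. *)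
  pose z1 := (y' ^+ l.+1 + x - t ^+ k) / x ^+ d.+2.
  have xd : x ^+ d.+2 != 0 by apply: expf_neq0.
  have V1 w : V (pt5 x y' z1 t w) by apply/koras_russell_pt5; rewrite mulrC divfK.
  rewrite (inv_y _ _ _ _ _ _ _ x0 Vv (V1 u)) (inv_u _ _ _ _ _ u') //.
  exact: inv_t.
have [N [mu [muA muE]]] := chart_flow_action aE bE k.
pose psi x y1 Z w t := @psi5 K d l Q1 E1 Q2 E2 k x y1 Z w t.
have psiV x y1 Z w t : t != 0 -> x * Z = y1 ^+ l.+1 - t ^+ k -> V (psi x y1 Z w t).
  exact: psi5_mem.
have flow a x y1 Z w t : t != 0 -> x * Z = y1 ^+ l.+1 - t ^+ k ->
    P.@[psi x y1 Z w t] = P.@[psi (flow_x l a x y1 Z) (y1 + a * Z) Z w t].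
  move=> t0 xZ; have Vv := psiV x y1 Z w t t0 xZ.
  (* The factor t^(-N) undoes the slowing down. *)
  have := inv mu muA (t ^- N * a) (exist _ _ Vv).
  rewrite (muE _ _ _ _ _ _ (exist _ _ Vv) t0 xZ erefl) mulrA divff ?expf_neq0 //.
  by rewrite mul1r => <-.
have l0 : l.+1%:R != 0 :> K by rewrite pnatr_eq0.
(* The base point has y1 = 1 and Z = 0: from it, the flow moves x from 0 to (l+1) a, hence to any
   value. *)
pose c := P.@[psi 0 1 0 0 1].
have cE x y z t u : x != 0 -> V (pt5 x y z t u) -> P.@[pt5 x y z t u] = c.
  move=> x0 Vv.
  have xZ w : w * 0 = 1 ^+ l.+1 - 1 ^+ k :> K by rewrite mulr0 !expr1n subrr.
  rewrite /c (flow (x / l.+1%:R) 0 1 0 0 1 (oner_neq0 _) (xZ 0)).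
  rewrite mulr0 addr0 /flow_x /pow_shift mulr0 addr0 add0r.
  rewrite pow_quotxx expr1n mulr1 divfK //.
  by apply: inv_x => //; apply: psiV; rewrite ?oner_neq0.
have cE' x y z t u : t != 0 -> V (pt5 x y z t u) -> P.@[pt5 x y z t u] = c.
  move=> t0 Vv; have [x0|] := eqVneq x 0; last by move=> x0; apply: cE.
  have [-> xZ] := psi5_phi aE bE t0 Vv; rewrite -/(psi _ _ _ _ _).
  move: (phi_y _ _ _) (phi_Z _ _ _ _ _ _) (phi_w _ _ _ _ _ _ _ _ _ _ _ _) xZ => y1 Z w xZ.
  have y10 : y1 != 0.
    apply: contra_eq_neq xZ => ->; rewrite x0 mul0r exprS mul0r sub0r.
    by rewrite eq_sym oppr_eq0 expf_neq0.
  (* Time chosen to leave x = 0: if Z = 0, x becomes (l+1) y1^l; otherwise y1 becomes 0 and x Z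
     becomes -t^k. Both are nonzero. *)
  pose a := if Z == 0 then 1 else - y1 / Z.
  rewrite (flow a) //; apply: cE; last first.
    by apply: psiV => //; apply: flow_model.
  rewrite /a; case: (eqVneq Z 0) => [->|Z0].
    rewrite /flow_x /pow_shift x0 mulr0 addr0 add0r mul1r pow_quotxx.
    by rewrite mulf_neq0 ?expf_neq0.
  suff : flow_x l (- y1 / Z) x y1 Z * Z != 0 by rewrite mulf_eq0 negb_or => /andP[].
  rewrite (flow_model _ xZ) divfK // subrr exprS mul0r sub0r oppr_eq0.
  by rewrite expf_neq0.
exists c; apply/funext => v; rewrite fP; case: v => v /=.
elim/pt5_ind: v => x y z t u Vv.
have [t0|t0] := eqVneq t 0; last exact: cE'.
have [x0|x0] := eqVneq x 0; last exact: cE.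
have y0 : y = 0.
  move: Vv => /koras_russell_pt5; rewrite x0 t0 exprS mul0r.
  rewrite expr0n (gtn_eqF k0) subr0 addr0 mul0r => /esym/eqP.
  by rewrite expf_eq0 => /eqP.
(* All the actions used preserve x = y = t = 0; its points are limits along the
   curves s |-> (0, s^k, z, s^(l+1), u). *)
pose C (h : K -> K) := exists q : {poly K}, forall s, h s = q.[s].
have algC : function_algebra C.
  split=> [b|h h' [q hq] [q' hq']|h h' [q hq] [q' hq']].
  - by exists b%:P => s; rewrite hornerC.
  - by exists (q + q') => s; rewrite hornerD hq hq'.
  - by exists (q * q') => s; rewrite hornerM hq hq'.
have CX : C id by exists 'X => s; rewrite hornerX.
have [q qE] : C (fun s => P.@[pt5 0 (s ^+ k) z (s ^+ l.+1) u]).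
  by apply: (algebra_meval algC); apply: pt5_components; function_algebra algC.
have -> : pt5 x y z t u = pt5 0 (0 ^+ k) z (0 ^+ l.+1) u.
  by rewrite x0 y0 t0 !expr0n (gtn_eqF k0).
rewrite qE; apply: horner_const_at0 => s s0; rewrite -qE.
apply: cE'; first exact: expf_neq0.
by apply/koras_russell_pt5; rewrite -!exprM mulnC addr0 subrr exprS !mul0r.
Qed.

(** * Specialization to the complex numbers *)

Unset Implicit Arguments.

Theorem corollary4 (R : realType) (d k l : nat) (hd : (2 <= d)%N)
    (hl : (2 <= l)%N) (hlk : (l < k)%N) (hcop : coprime l k) :
  ML (cylinder (koras_russell R[i] d k l)) =
  [set f | exists c : R[i], f = (fun=> c)].
Proof.
case: d hd => [|[|d]] // _; case: l hl hlk hcop => // l _ lk _.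
apply/seteqP; split=> f /=.
  by apply: ML_cylinder_koras_russell; apply: leq_ltn_trans lk.
move=> [c ->]; split=> //; exact: (algebra_cst (regular_algebra _)).
Qed.
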